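(* (1) Let $1\le n<\omega$ and $d\in\omega$. If $\varphi(x,y_0,\ldots,y_{n-1})$ is an $n$-dependent formula (with respect to a theory $T$) with $\dim(\varphi)\leq d$, then for every natural number $m\geq d$, $$\pi_\varphi(m)\leq\sum_{i<z}\binom{m^n}{i},\qquad\text{where } z=z_n(m,d+1).$$ In particular, for $m\gg n,d$ (that is, for all $m$ sufficiently large with respect to $n$ and $d$), $$\pi_\varphi(m)\leq 2^{c\,m^{n-\varepsilon}\log_2 m}\leq 2^{m^{n-\varepsilon'}},$$ where $c=n^{n+1-\varepsilon}$, $\varepsilon=\dfrac{1}{(d+1)^{n-1}}$ and $\varepsilon'=\varepsilon'(n,d)>0$ is small enough. (2) There are $c>0$, a theory $T$ and a formula $\varphi(x,y_0,y_1)$ such that $\varphi$ is $2$-dependent (with respect to $T$) and $\pi_\varphi(m)\geq 2^{c\,m^{3/2}}$ for every natural number $m$.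
   Context: $T$ is a first-order theory and types are computed in a monster model of $T$; the variables $x,y_0,\ldots,y_{n-1}$ may be finite tuples. A formula $\varphi(x;y_0,\ldots,y_{n-1})$ has the $n$-independence property ($\mathrm{IP}_n$) with respect to $T$ if in some model of $T$ there is a sequence $(a_{0,i},\ldots,a_{n-1,i})_{i\in\omega}$ such that for every $s\subseteq\omega^n$ there is $b_s$ with $\models\varphi(b_s;a_{0,i_0},\ldots,a_{n-1,i_{n-1}})\Leftrightarrow (i_0,\ldots,i_{n-1})\in s$. Otherwise $\varphi$ is $n$-dependent. For sets $A_k$ of tuples of length $|y_k|$ ($k<n$), a complete $\varphi$-type over $(A_0,\ldots,A_{n-1})$ is a maximal consistent set of formulas of the form $\varphi(x,a_0,\ldots,a_{n-1})$ or $\neg\varphi(x,a_0,\ldots,a_{n-1})$ with $a_k\in A_k$; $S_\varphi(A_0,\ldots,A_{n-1})$ is the set of all such types. For $m\in\omega$, $\pi_\varphi(m)=\sup\{|S_\varphi(B_0,\ldots,B_{n-1})|: |B_0|=\cdots=|B_{n-1}|=m\}$. One has $\pi_\varphi(m)\le 2^{m^n}$, and $\varphi$ is $n$-dependent if and only if there is $d\in\omega$ with $\pi_\varphi(m)=2^{m^n}$ for $m\leq d$ and $\pi_\varphi(m)<2^{m^n}$ for $m>d$; this number $d$ is denoted $\dim(\varphi)$. An $n$-partite $n$-uniform hypergraph has its vertex set partitioned into $n$ parts, and each edge consists of exactly one vertex from each part. $G^{(n)}(m)$ denotes any $n$-partite $n$-uniform hypergraph all of whose parts have exactly $m$ vertices,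 and $K^{(n)}(d)$ denotes the complete one with all parts of size $d$. The Zarankiewicz number $z_n(m,d)$ is the minimum natural number $z$ such that every $G^{(n)}(m)$ having at least $z$ edges contains $K^{(n)}(d)$ as a subgraph.
   Formalization: The bound π_φ(m) ≤ 2^{c m^{n-ε} log₂ m} is proved only for n ≥ 2 or d = 0: for n = 1, d ≥ 1 it would say π_φ(m) ≤ m, which fails for x < y in (Q,<), where π_φ(m) = m+1; the bound π_φ(m) ≤ 2^{m^{n-ε'}} is kept for all n ≥ 1. *)

(* Defs.v *)
From HB Require Import structures.
From mathcomp Require Import all_boot all_order all_algebra.
From mathcomp Require Import all_classical all_reals.
From mathcomp Require Import exp.

Set Implicit Arguments.
Unset Strict Implicit.
Unset Printing Implicit Defensive.

Definition is_transversal_edge (n : nat) (V : finType) (part : V -> 'I_n)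
    (e : {set V}) : bool :=
  [forall k, #|[set v in e | part v == k]| == 1%N].

Record hypergraph (n : nat) : Type := Hypergraph {
  vertex : finType;
  part : vertex -> 'I_n;
  edges : {set {set vertex}};
  edgesP : forall e, e \in edges -> is_transversal_edge part e }.

Definition parts_size (n : nat) (G : hypergraph n) (m : nat) : Prop :=
  forall k : 'I_n, #|[set v : vertex G | part v == k]| = m.

Lemma complete_edgesP (n d : nat) (e : {set 'I_n * 'I_d}) :
  e \in [set e | is_transversal_edge fst e] -> is_transversal_edge fst e.
Proof. by rewrite inE. Qed.

Definition complete_hypergraph (n d : nat) : hypergraph n :=
  Hypergraph (@complete_edgesP n d).

Definition subgraph (n : nat) (H G : hypergraph n) : Prop :=
  exists f : vertex H -> vertex G, injective f /\
  forall e : {set vertex H}, e \in edges H -> f @: e \in edges G.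

Definition zarankiewicz_bound (n m d z : nat) : Prop :=
  forall G : hypergraph n, parts_size G m -> (z <= #|edges G|)%N ->
  subgraph (complete_hypergraph n d) G.

Lemma zarankiewicz_ex (n m d : nat) :
  exists z, `[< zarankiewicz_bound n m d z >].
Proof.
exists (2 ^ (n * m)).+1; apply/asboolP => G Gm; rewrite ltnNge => /negP[].
suff <- : #|vertex G| = (n * m)%N.
  by rewrite -cardsT -card_powerset powersetT cardsT max_card.
rewrite -sum1_card (partition_big (@part n G) predT) //=.
rewrite (eq_bigr (fun=> m)) ?sum_nat_const ?card_ord // => k _.
by rewrite sum1_card -[RHS](Gm k) cardsE.
Qed.

Definition zarankiewicz (n m d : nat) : nat := ex_minn (zarankiewicz_ex n m d).

Local Open Scope classical_set_scope.
Local Open Scope card_scope.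

Record language : Type := Language {
  fun_sym : Type; fun_arity : fun_sym -> nat;
  rel_sym : Type; rel_arity : rel_sym -> nat }.

Inductive term (L : language) (V : Type) : Type :=
| Var of V
| App (f : fun_sym L) of ('I_(fun_arity f) -> term L V).

(* [formula L V] is the type of formulas whose free variables are in [V];
   [All] binds the variable [None : option V].  The other connectives are
   classically definable. *)
Inductive formula (L : language) (V : Type) : Type :=
| Bot
| Eq of term L V & term L V
| Rel (r : rel_sym L) of ('I_(rel_arity r) -> term L V)
| Imp of formula L V & formula L V
| All of formula L (option V).

Record structure (L : language) : Type := Structure {
  carrier :> Type;
  carrier_point : carrier;
  fun_int : forall f : fun_sym L, (fun_arity f).-tuple carrier -> carrier;
  rel_int : forall r : rel_sym L, (rel_arity r).-tuple carrier -> Prop }.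

Section Semantics.
Context (L : language) (M : structure L).

Fixpoint eval (V : Type) (e : V -> M) (t : term L V) : M :=
  match t with
  | Var v => e v
  | App f ts => fun_int [tuple eval e (ts i) | i < fun_arity f]
  end.

Fixpoint sat (V : Type) (phi : formula L V) : (V -> M) -> Prop :=
  match phi with
  | Bot => fun=> False
  | Eq t u => fun e => eval e t = eval e u
  | Rel r ts => fun e => rel_int [tuple eval e (ts i) | i < rel_arity r]
  | Imp p q => fun e => sat p e -> sat q e
  | All p => fun e => forall x : M, sat p (fun o => if o is Some v then e v else x)
  end.

End Semantics.

Definition sentence (L : language) : Type := formula L void.
Definition theory (L : language) : Type := set (sentence L).

Definition holds (L : language) (M : structure L) (s : sentence L) : Prop :=
  sat s (of_void M).

Definition models (L : language) (M : structure L) (T : theory L) : Prop :=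
  forall s, T s -> holds M s.

Definition satisfiable (L : language) (T : theory L) : Prop :=
  exists M : structure L, models M T.

Definition complete_theory (L : language) (T : theory L) : Prop :=
  satisfiable T /\
  forall s : sentence L,
    (forall M : structure L, models M T -> holds M s) \/
    (forall M : structure L, models M T -> ~ holds M s).

(* [lx] is the length of the tuple x and [ly k] the length of the tuple y_k. *)
Definition pformula (L : language) (n lx : nat) (ly : 'I_n -> nat) : Type :=
  formula L ('I_lx + {k : 'I_n & 'I_(ly k)}).

Section Types.
Context (L : language) (n lx : nat) (ly : 'I_n -> nat).
Implicit Types (T : theory L) (M : structure L) (phi : pformula L lx ly).

Definition psat M phi (b : lx.-tuple M) (a : forall k, (ly k).-tuple M) : Prop :=
  sat phi (fun v => match v with
                    | inl i => tnth b i
                    | inr j => tnth (a (tag j)) (tagged j)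
                    end).

Definition IP T phi : Prop :=
  exists M, models M T /\
  exists a : forall k : 'I_n, nat -> (ly k).-tuple M,
  forall s : set (n.-tuple nat), exists b : lx.-tuple M,
  forall i : n.-tuple nat, psat phi b (fun k => a k (tnth i k)) <-> s i.

Definition n_dependent T phi : Prop := ~ IP T phi.

(* The pair [(true, a)] stands for the formula phi(x, a) and [(false, a)] for
   its negation. *)
Definition inst M : Type := (bool * (forall k, (ly k).-tuple M))%type.

Definition inst_holds M phi (b : lx.-tuple M) (l : inst M) : Prop :=
  if l.1 then psat phi b l.2 else ~ psat phi b l.2.

Definition inst_over M (B : forall k, set ((ly k).-tuple M)) : set (inst M) :=
  [set l | forall k, B k (l.2 k)].

(* Finite satisfiability in M; by compactness this is consistency with the
   theory of M with parameters. *)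
Definition consistent M phi (p : set (inst M)) : Prop :=
  forall q, finite_set q -> q `<=` p ->
  exists b : lx.-tuple M, forall l, q l -> inst_holds phi b l.

Definition complete_types M phi (B : forall k, set ((ly k).-tuple M)) :
    set (set (inst M)) :=
  [set p | [/\ p `<=` inst_over B, consistent phi p &
    forall q, q `<=` inst_over B -> consistent phi q -> p `<=` q -> q = p]].

(* M plays the role of the monster model.  Only finite parameter sets occur, so
   the value depends on the theory of M only and no saturation is required.
   The supremum is taken in nat, with value 0 on the empty set. *)
Definition pi_phi M phi (m : nat) : nat :=
  supremum 0%N [set c | exists B : forall k, set ((ly k).-tuple M),
    (forall k, B k #= `I_m) /\ complete_types phi B #= `I_c].

Definition is_dim M phi (d : nat) : Prop :=
  (forall m, (m <= d)%N -> pi_phi M phi m = (2 ^ (m ^ n))%N) /\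
  (forall m, (d < m)%N -> (pi_phi M phi m < 2 ^ (m ^ n))%N).

Definition dim_le M phi (d : nat) : Prop :=
  exists2 d0 : nat, is_dim M phi d0 & (d0 <= d)%N.

End Types.

Definition log2 (R : realType) (x : R) : R := (ln x / ln 2)%R.

(* Main.v *)
Require Import Defs.
From HB Require Import structures.
From mathcomp Require Import all_boot all_order all_algebra.
From mathcomp Require Import all_classical all_reals.
From mathcomp Require Import exp.
From mathcomp Require Import finfield.
From mathcomp Require Import zify ring lra.

Set Implicit Arguments.
Unset Strict Implicit.
Unset Printing Implicit Defensive.

Local Open Scope ring_scope.
Import Order.TTheory GRing.Theory Num.Theory.

(** Upper bound. Index the parameters by the grid of functions from ['I_n] to
    ['I_m]. Each realisation of a type cuts out a subset of the grid, and
    types correspond to these traces ([complete_typesE]). By the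
    Sauer-Shelah lemma ([sauer_shelah]), a family of more than [\sum_(i < z)
    'C(m ^ n, i)] subsets shatters a set of at least [z] points. A set of
    points of the grid is an [n]-partite [n]-uniform hypergraph, so for [z =
    zarankiewicz n m d.+1] the shattered set contains a box of side [d.+1]
    ([zarankiewicz_has_box]). The formula then has all possible types over
    the sides of the box, which [dim_le] forbids.

    Asymptotics. Erdos's theorem ([box_free_bound]) bounds a box-free subset
    of the grid by [2 * m `^ (n - eps)], by induction on [n]: one counts the
    tuples of [d.+1] points on the lines parallel to the first axis. Since
    [\sum_(i < z) 'C(N, i) <= N ^ z], the first estimate follows for [2 <= n]
    (when [d = 0], a single edge is already a box). The logarithm is then
    absorbed by half of the gain [eps]. For [n = 1] the number of types is at
    most [m ^ d.+1], which gives the last estimate.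

    Example. Point-line incidence graphs of affine planes over finite fields
    contain no [K22] and have on the order of [m `^ (3 / 2)] edges
    ([K22_free_large]). Consider the structure whose elements are vertices of
    such graphs, one for each size, and codes for sets of edges; the ternary
    relation says that a code contains an edge. A single code spans a graph
    without [K22], a first-order property which excludes independence; every
    subset of the edges has a code, so the number of types is at least
    exponential in the number of edges. *)

(** * Shattering *)

Section Pajor.
Import mathcomp.boot.fintype mathcomp.boot.finset.
Context (T : finType).
Implicit Types (F G : {set {set T}}) (S A B : {set T}).

Definition shattered F S :=
  [forall A : {set T}, (A \subset S) ==> [exists B in F, B :&: S == A]].

Definition shattered_sets F : {set {set T}} := [set S | shattered F S].

Lemma shatteredP F S : reflect
  (forall A, A \subset S -> exists2 B, B \in F & B :&: S = A) (shattered F S).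
Proof.
apply: (iffP forallP) => [H A AS|H A]; last first.
  by apply/implyP => /H[B BF <-]; apply/existsP; exists B; rewrite BF /=.
by have /implyP/(_ AS)/existsP[B /andP[BF /eqP <-]] := H A; exists B.
Qed.

Lemma shattered_mono F G S : F \subset G -> shattered F S -> shattered G S.
Proof.
move=> /subsetP FG /shatteredP H; apply/shatteredP => A /H[B /FG BG <-].
by exists B.
Qed.

(** Pajor's form of the Sauer-Shelah lemma, by induction on the family: split
    [F] into the members [F1] containing [x] and the members [F0] avoiding
    it, both nonempty. A set shattered by [F0] or by [F1] avoids [x] and is
    shattered by [F]; when it is shattered by both, adding [x] gives one
    more set shattered by [F]. So [F] shatters at least as many sets as [F0]
    and [F1] together. *)
Lemma card_le_shatter F : (#|F| <= #|shattered_sets F|)%N.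
Proof.
have [N] := ubnP #|F|; elim: N => // N IH in F *; rewrite ltnS => leFN.
have [F0|[B0 B0F]] := set_0Vmem F; first by rewrite F0 cards0.
have [/existsP[x /andP[Fx Fnx]]|/existsPn Fno] := boolP [exists x : T,
    [exists A in F, x \in A] && [exists A in F, x \notin A]]; last first.
  have /subset_leq_card/leq_trans -> // : F \subset [set B0].
    apply/subsetP => B BF; rewrite inE; apply/eqP/setP => x.
    have := Fno x; rewrite negb_and => /orP[/exists_inPn H|/exists_inPn H].
      by rewrite !(negbTE (H _ _)).
    by have := H _ BF; have := H _ B0F; rewrite !negbK => -> ->.
  rewrite cards1 card_gt0; apply/set0Pn; exists set0; rewrite inE.
  apply/shatteredP => A; rewrite subset0 => /eqP ->; exists B0 => //.
  by rewrite setI0.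
have [A1 A1F xA1] := exists_inP Fx; have [A2 A2F xA2] := exists_inP Fnx.
pose F1 := [set A in F | x \in A]; pose F0 := [set A in F | x \notin A].
have F1F : F1 \subset F by apply/subsetP => A; rewrite inE => /andP[].
have F0F : F0 \subset F by apply/subsetP => A; rewrite inE => /andP[].
have lt1 : (#|F1| < #|F|)%N.
  apply: proper_card; apply/properP; split=> //; exists A2 => //.
  by rewrite inE A2F.
have lt0 : (#|F0| < #|F|)%N.
  apply: proper_card; apply/properP; split=> //; exists A1 => //.
  by rewrite inE A1F negbK.
have nx1 S : S \in shattered_sets F1 -> x \notin S.
  rewrite inE => /shatteredP H; apply/negP => xS.
  have [B + /setP/(_ x)] := H set0 (sub0set _).
  by rewrite !inE xS => /andP[_ ->].
have nx0 S : S \in shattered_sets F0 -> x \notin S.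
  rewrite inE => /shatteredP H; apply/negP => xS.
  have [B + /setP/(_ x)] := H S (subxx _).
  by rewrite !inE xS andbT => /andP[_ /negbTE ->].
have -> : #|F| = (#|F0| + #|F1|)%N.
  rewrite -cardsUI (_ : F0 :&: F1 = set0) ?cards0 ?addn0.
    apply: eq_card => A; rewrite !inE; by case: (A \in F); case: (x \in A).
  by apply/setP => A; rewrite !inE; case: (A \in F); case: (x \in A).
apply: leq_trans (leq_add (IH F0 (leq_trans lt0 leFN)) (IH F1 (leq_trans lt1
  leFN))) _.
rewrite -cardsUI -(card_in_imset (f := fun S => x |: S)
  (D := mem (shattered_sets F0 :&: shattered_sets F1))); last first.
  move=> S S' /setIP[/nx0 xS _] /setIP[/nx0 xS' _] e.
  by rewrite -(setU1K xS) -(setU1K xS') e.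
rewrite -cardsUI [X in (_ + #|pred_of_set X|)%N](_ : _ = set0) ?cards0 ?addn0.
  apply: subset_leq_card; apply/subsetP => S /setUP[/setUP[]|].
  - by rewrite !inE; apply: shattered_mono.
  - by rewrite !inE; apply: shattered_mono.
  case/imsetP => S' /setIP[S0 S1] ->{S}; have xS := nx0 _ S0.
  rewrite inE; apply/shatteredP => A AS.
  have AS' : A :\ x \subset S' by rewrite subDset.
  have [xA|xA] := boolP (x \in A).
    move: S1; rewrite inE => /shatteredP/(_ _ AS')[B].
    rewrite inE => /andP[BF xB] BE; exists B => //.
    rewrite setIUr BE (_ : B :&: [set x] = [set x]) ?setD1K //.
    by apply/setIidPr; rewrite sub1set.
  move: S0; rewrite inE => /shatteredP/(_ _ AS')[B].
  rewrite inE => /andP[BF xB] BE; exists B => //.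
  rewrite setIUr BE (_ : B :&: [set x] = set0) ?set0U.
    by apply/setP => y; rewrite !inE; case: eqP => // ->; rewrite (negbTE xA).
  by apply/setP => y; rewrite !inE; case: eqP => [->|];
    rewrite ?(negbTE xB) ?andbF.
apply/setP => S; rewrite !inE; apply/negP => /andP[H /imsetP[S' _ SE]].
have xS : x \in S by rewrite SE setU11.
by case/orP: H => H; [move: (nx0 S)|move: (nx1 S)];
  rewrite inE H xS => /(_ isT).
Qed.

Lemma card_small_sets z :
  #|[set S : {set T} | #|S| < z]%N| = (\sum_(i < z) 'C(#|T|, i))%N.
Proof.
elim: z => [|z IH]; first by rewrite big_ord0; apply: eq_card0 => S;
  rewrite inE.
rewrite big_ord_recr /= -IH -card_draws -cardsUI.
rewrite [X in (_ + #|pred_of_set X|)%N](_ : _ = set0) ?cards0 ?addn0.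
  by apply: eq_card => S; rewrite !inE ltnS leq_eqVlt orbC.
by apply/setP => S; rewrite !inE; apply/negP => /andP[/[swap]/eqP ->];
  rewrite ltnn.
Qed.

Lemma sauer_shelah F z : (\sum_(i < z) 'C(#|T|, i) < #|F|)%N ->
  exists2 S, shattered F S & (z <= #|S|)%N.
Proof.
move=> ltF; apply: contrapT => noS; move: ltF; rewrite ltnNge => /negP; apply.
apply: leq_trans (card_le_shatter F) _; rewrite -card_small_sets.
apply: subset_leq_card; apply/subsetP => S; rewrite !inE => Ssh.
by rewrite ltnNge; apply/negP => zS; apply: noS; exists S.
Qed.
End Pajor.

(** * Boxes and complete subhypergraphs *)

Section Box.
Import mathcomp.boot.fintype mathcomp.boot.finset.

(** The shape of a copy of the complete hypergraph whose [k]-th part lies in the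
    [k]-th part of the host: edges are functions picking a vertex of ['I_m] in
    each of the [n] parts. *)
Definition has_box (n m l : nat) (E : {set {ffun 'I_n -> 'I_m}}) : Prop :=
  exists2 f : 'I_n -> 'I_l -> 'I_m, forall k, injective (f k) &
    forall j : {ffun 'I_n -> 'I_l}, [ffun k => f k (j k)] \in E.

(** An [n]-partite hypergraph with parts of size [m] is handled through a
    labelling of each part by ['I_m]: its possible edges are then the
    transversals of the functions from ['I_n] to ['I_m]. *)
Section Labelling.
Context (n m : nat) (V : finType) (part : V -> 'I_n) (lab : 'I_n -> 'I_m -> V).
Context (part_lab : forall k i, part (lab k i) = k).
Context (lab_inj : forall k, injective (lab k)).
Context (lab_surj : forall v, exists i, lab (part v) i = v).

Definition transversal (y : {ffun 'I_n -> 'I_m}) : {set V} :=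
  [set lab k (y k) | k : 'I_n].

Lemma mem_transversal y k i : (lab k i \in transversal y) = (i == y k).
Proof.
apply/imsetP/eqP => [[k' _ e]|->]; last by exists k.
have ek : k = k' by rewrite -(part_lab k i) e part_lab.
by move: e; rewrite -ek => /lab_inj.
Qed.

Lemma transversal_inj : injective transversal.
Proof.
move=> y y' e; apply/ffunP => k; apply/eqP.
by rewrite -mem_transversal -e mem_transversal.
Qed.

Lemma transversal_edge y : is_transversal_edge part (transversal y).
Proof.
apply/forallP => k; apply/cards1P; exists (lab k (y k)).
apply/setP => v; rewrite !inE; have [i <-] := lab_surj v.
rewrite part_lab mem_transversal; apply/andP/eqP => [[/eqP -> /eqP -> //]|e].
have ek : part v = k by rewrite -(part_lab (part v) i) e part_lab.
by move: e; rewrite ek => /lab_inj ->.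
Qed.

Lemma edge_transversal e : is_transversal_edge part e ->
  exists y, e = transversal y.
Proof.
move=> /forallP eT.
have /choice[y yP] k : exists i, [set v in e | part v == k] = [set lab k i].
  have /cards1P[v ev] := eT k; have [i vE] := lab_surj v.
  have : v \in [set v in e | part v == k] by rewrite ev set11.
  by rewrite inE => /andP[_ /eqP vk]; exists i; rewrite ev -vE vk.
exists (finfun y); apply/setP => v; have [i <-] := lab_surj v.
rewrite mem_transversal ffunE; set k := part v.
have /setP/(_ (lab k i)) := yP k.
by rewrite !inE part_lab eqxx andbT (inj_eq (@lab_inj k)).
Qed.

End Labelling.

Lemma pair_surj (I J : Type) (v : I * J) : exists i, (v.1, i) = v.
Proof. by case: v => a b; exists b. Qed.

Lemma pair_injr (I J : Type) (k : I) : injective (fun j : J => (k, j)).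
Proof. by move=> ? ? []. Qed.

Lemma complete_edges_transversal n l (e : {set 'I_n * 'I_l}) :
  reflect (exists y, e = transversal (fun k i => (k, i)) y)
          (e \in edges (complete_hypergraph n l)).
Proof.
rewrite inE; apply: (iffP idP) => [eT|[y ->]].
  by apply: edge_transversal eT => //; [apply: pair_injr|apply: pair_surj].
by apply: transversal_edge => //; [apply: pair_injr|apply: pair_surj].
Qed.

Definition box_hypergraph n m (E : {set {ffun 'I_n -> 'I_m}}) : hypergraph n.
Proof.
refine (@Hypergraph n ('I_n * 'I_m)%type fst
  [set transversal (fun k i => (k, i)) y | y in E] _).
abstract (by move=> e /imsetP[y _ ->]; apply: transversal_edge => //;
  [apply: pair_injr|apply: pair_surj]).
Defined.

Lemma box_hypergraph_parts n m (E : {set {ffun 'I_n -> 'I_m}}) :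
  parts_size (box_hypergraph E) m.
Proof.
move=> k; rewrite -[RHS]card_ord -(card_imset (mem 'I_m) (@pair_injr _ 'I_m k)).
apply: eq_card => -[k' i]; rewrite inE /=.
by apply/eqP/imsetP => [->|[j _ [->]]//]; exists i.
Qed.

(** An embedding of the complete hypergraph need not preserve the parts, but it
    permutes them: exchanging one vertex of an edge for another one of the same
    part changes a single vertex of the image, which has to stay in its part.
    Composing with the inverse permutation yields a box. *)
Lemma subgraph_has_box n m l (E : {set {ffun 'I_n -> 'I_m}}) : (0 < l)%N ->
  subgraph (complete_hypergraph n l) (box_hypergraph E) -> has_box l E.
Proof.
case: l => // l _ [f [f_inj fE]];
  pose gr p := @transversal n p _ (fun k i => (k, i)).
have grP p (j : {ffun 'I_n -> 'I_p}) k i : ((k, i) \in gr p j) = (i == j k).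
  by apply: (mem_transversal (part := fst)) => //; apply: pair_injr.
have fgr j : exists2 y, y \in E & f @: gr l.+1 j = gr m y.
  have /fE/imsetP[y yE fy] : gr l.+1 j \in edges (complete_hypergraph n l.+1).
    by apply/complete_edges_transversal; exists j.
  by exists y.
have mem_fgr j y k : f @: gr l.+1 j = gr m y -> f (k, j k) \in gr m y.
  by move=> <-; apply: imset_f; rewrite grP.
(* The edges of [j a] and [j a'] have all their vertices in common except the
   one in the part [k]. *)
have part_const k a a' : (f (k, a)).1 = (f (k, a')).1.
  pose j b : {ffun 'I_n -> 'I_l.+1} := [ffun k' => if k' == k then b else ord0].
  have [y _ jy] := fgr (j a); have [y' _ jy'] := fgr (j a').
  set k1 := (f (k, a)).1.
  have fa : f (k, a) = (k1, y k1).
    have := mem_fgr _ _ k jy; rewrite ffunE eqxx /k1.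
    by case: (f (k, a)) => k0 i; rewrite grP => /eqP ->.
  have : (k1, y' k1) \in f @: gr l.+1 (j a') by rewrite jy' grP.
  case/imsetP => -[k2 i]; rewrite grP => /eqP ->; rewrite ffunE.
  case: eqP => [-> <- //|/eqP k2k e].
  have : f (k2, ord0) \in gr m y.
    by have := mem_fgr _ _ k2 jy; rewrite ffunE (negbTE k2k).
  rewrite -e grP => /eqP ey; move: e; rewrite ey -fa => /f_inj[k2E _].
  by rewrite k2E eqxx in k2k.
pose s k := (f (k, ord0)).1.
have s_inj : injective s.
  have [y _ jy] := fgr [ffun=> ord0] => k k' e.
  have fk k0 : f (k0, ord0) = (s k0, y (s k0)).
    have := mem_fgr _ _ k0 jy; rewrite ffunE /s.
    by case: (f (k0, ord0)) => k1 i; rewrite grP => /eqP ->.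
  by have : f (k, ord0) = f (k', ord0) by [rewrite !fk e]; move=> /f_inj[].
pose t := invF s_inj.
have f1 k a : (f (t k, a)).1 = k by rewrite (part_const _ a ord0) -/(s _)
  f_invF.
exists (fun k a => (f (t k, a)).2) => [k a a' e|j].
  have : f (t k, a) = f (t k, a').
    by rewrite [LHS]surjective_pairing [RHS]surjective_pairing !f1 e.
  by move=> /f_inj[].
have [y yE jy] := fgr [ffun k => j (s k)].
suff -> : [ffun k => (f (t k, j k)).2] = y by [].
apply/ffunP => k; rewrite ffunE.
have := mem_fgr _ _ (t k) jy; rewrite ffunE f_invF.
by rewrite [f _]surjective_pairing grP f1 => /eqP.
Qed.

Lemma zarankiewicz_has_box n m l (E : {set {ffun 'I_n -> 'I_m}}) :
  (0 < l)%N -> (zarankiewicz n m l <= #|E|)%N -> has_box l E.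
Proof.
move=> l0; rewrite /zarankiewicz; case: ex_minnP => z /asboolP zP _ zE.
apply: subgraph_has_box => //; apply: zP; first exact: box_hypergraph_parts.
rewrite card_imset //; by apply: (transversal_inj (part := fst)) => //;
  apply: pair_injr.
Qed.

Lemma zarankiewicz_le n m l z :
  (forall E : {set {ffun 'I_n -> 'I_m}}, (z <= #|E|)%N -> has_box l E) ->
  (zarankiewicz n m l <= z)%N.
Proof.
move=> zP; rewrite /zarankiewicz; case: ex_minnP => z0 _; apply.
apply/asboolP => G Gm zG.
have /choice[lab0 lab0P] k : exists g : 'I_m -> vertex G,
    injective g /\ codom g =i [set v | part v == k].
  have e := Gm k; exists (fun i => enum_val (cast_ord (esym e) i)); split.
    by move=> i j /enum_val_inj/cast_ord_inj.
  move=> v; apply/codomP/idP => [[i ->]|vk]; first exact: enum_valP.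
  exists (cast_ord e (enum_rank_in vk v)).
  by rewrite cast_ordK enum_rankK_in.
have part_lab k i : part (lab0 k i) = k.
  by have := codom_f (lab0 k) i; rewrite (lab0P k).2 inE => /eqP.
have lab_inj k : injective (lab0 k) := (lab0P k).1.
have lab_surj v : exists i, lab0 (part v) i = v.
  have : v \in codom (lab0 (part v)) by rewrite (lab0P _).2 inE.
  by case/codomP => i ->; exists i; rewrite part_lab.
pose E := [set y | transversal lab0 y \in edges G].
have [|f f_inj fE] := zP E.
  apply: leq_trans zG _; rewrite -(card_imset E (transversal_inj part_lab
    lab_inj)).
  apply: subset_leq_card; apply/subsetP => e eG.
  have [y ey] := edge_transversal part_lab lab_inj lab_surj (edgesP eG).
  by apply/imsetP; exists y; rewrite // inE -ey.
exists (fun v => lab0 v.1 (f v.1 v.2)); split.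
  move=> [k a] [k' a'] /= e.
  have ek : k = k' by rewrite -(part_lab k (f k a)) e part_lab.
  by move: e; rewrite -ek => /lab_inj/f_inj ->.
move=> e /complete_edges_transversal[j ->]; have := fE j; rewrite inE.
suff -> : [set lab0 v.1 (f v.1 v.2) | v in transversal (fun k i => (k, i)) j] =
  transversal lab0 [ffun k => f k (j k)] by [].
rewrite /transversal -imset_comp; apply: eq_imset => k /=.
by rewrite ffunE.
Qed.

End Box.

(** * Erdos's bound for box-free sets *)

Section Erdos.
Import mathcomp.boot.fintype mathcomp.boot.finset.
Local Open Scope nat_scope.

(** Two similarly ordered pairs; this is the term-by-term comparison behind
    Chebyshev's sum inequality in [power_mean]. *)
Lemma rearrangement (a b c d : nat) : (a <= c) = (b <= d) ->
  a * d + c * b <= a * b + c * d.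
Proof.
case: (leqP a c) => [ac bd|ca bd].
  have {}bd : b <= d by rewrite -bd.
  rewrite -(subnKC ac) -(subnKC bd); move: (c - a) (d - b) => u v.
  by rewrite !mulnDl !mulnDr; lia.
have {}bd : d < b by rewrite ltnNge -bd.
rewrite -(subnKC (ltnW ca)) -(subnKC (ltnW bd)); move: (a - c) (b - d) => u v.
by rewrite !mulnDl !mulnDr; lia.
Qed.

Lemma power_mean (T : finType) (a : T -> nat) l :
  (\sum_i a i) ^ l.+1 <= #|T| ^ l * \sum_i a i ^ l.+1.
Proof.
elim: l => [|l IH]; first by rewrite mul1n expn1.
rewrite expnS; apply: leq_trans (leq_mul (leqnn _) IH) _.
rewrite mulnCA [#|T| ^ l.+1]expnSr -mulnA leq_mul2l; apply/orP; right.
(* Both sides are doubled, so that the terms (i, j) and (j, i) can be paired. *)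
rewrite -(leq_pmul2l (isT : 0 < 2)) !mul2n -!addnn.
have eL : (\sum_i a i) * (\sum_i a i ^ l.+1) = \sum_i \sum_j a i * a j ^ l.+1.
  by rewrite big_distrl; apply: eq_bigr => i _; rewrite big_distrr.
have eR : #|T| * (\sum_i a i ^ l.+2) = \sum_i \sum_(j : T) a i * a i ^ l.+1.
  rewrite big_distrr; apply: eq_bigr => i _.
  by rewrite sum_nat_const expnS.
rewrite {1}eL {1}eR [X in _ + X]eL [X in _ <= _ + X]eR.
rewrite [X in _ + X]exchange_big [X in _ <= _ + X]exchange_big -!big_split.
apply: leq_sum => i _; rewrite -!big_split; apply: leq_sum => j _ /=.
by apply: rearrangement; rewrite leq_exp2r.
Qed.

Lemma ffact_le_exp m l : m ^_ l <= m ^ l.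
Proof.
elim: l => // l IHl; rewrite ffactnSr expnSr.
by apply: leq_mul => //; apply: leq_subr.
Qed.

(** Few of the maps from ['I_l] to ['I_m] fail to be injective: a collision
    takes one of the ['C(l, 2)] pairs and leaves [l.-1] free values. *)
Lemma ffact_deficit m l : m ^ l <= m ^_ l + 'C(l, 2) * m ^ l.-1.
Proof.
elim: l => // -[|l] IH; first by rewrite ffactn1 expn1 leq_addr.
rewrite expnSr ffactnSr binS bin1 /=.
apply: leq_trans (leq_mul IH (leqnn m)) _.
rewrite mulnDl mulnDl addnA -mulnA -expnSr addnAC leq_add2r.
have [lm|ml] := leqP l.+1 m.
  by rewrite -[X in _ * X <= _](subnK lm) mulnDr leq_add2l mulnC leq_mul2l
    ffact_le_exp orbT.
by rewrite ffact_small.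
Qed.

Definition fcons (n m : nat) (p : 'I_m * {ffun 'I_n ->
  'I_m}) : {ffun 'I_n.+1 -> 'I_m} :=
  [ffun k => if unlift ord0 k is Some k' then p.2 k' else p.1].

Lemma fcons_bij n m : bijective (@fcons n m).
Proof.
exists (fun z : {ffun 'I_n.+1 -> 'I_m} => (z ord0, [ffun k : 'I_n =>
  z (lift ord0 k)])) => [[x y]|z].
  congr pair; first by rewrite ffunE unlift_none.
  by apply/ffunP => k; rewrite !ffunE liftK.
by apply/ffunP => k; rewrite ffunE; case: unliftP => [k'|] -> //=;
  rewrite ffunE.
Qed.

(** A box in the common slice of [E] at [l] distinct first coordinates would
    extend to a box of [E]. *)
Lemma box_free_slice n m l (E : {set {ffun 'I_n.+1 -> 'I_m}})
    (x : 'I_l -> 'I_m) : injective x -> ~ has_box l E ->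
  ~ has_box l [set y | [forall i, fcons (x i, y) \in E]].
Proof.
move=> x_inj noE [f f_inj fE]; case: noE.
exists (fun k => if unlift ord0 k is Some k' then f k' else x) => [k|j].
  by case: (unlift ord0 k).
have := fE [ffun k => j (lift ord0 k)]; rewrite inE => /forallP/(_ (j ord0)).
apply: etrans; congr (_ \in E); apply/ffunP => k; rewrite !ffunE.
by case: unliftP => [k'|] -> //; rewrite !ffunE.
Qed.

(** The dimension step of Erdos's theorem. The [l.+1]-st powers of the degrees
    of the points [y] count the pairs of a tuple [x] of [l.+1] first
    coordinates and a [y] in all the slices at [x]. For injective [x] there
    are at most [e] such [y], the common slice being free of boxes, and
    noninjective [x] are rare; the power mean inequality compares the count
    with [#|E|]. *)
Lemma box_free_step n m l e :
  (forall E : {set {ffun 'I_n -> 'I_m}}, ~ has_box l.+1 E -> #|E| <= e) ->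
  forall E : {set {ffun 'I_n.+1 -> 'I_m}}, ~ has_box l.+1 E ->
  #|E| ^ l.+1 <= (m ^ n) ^ l * (m ^ l.+1 * e + 'C(l.+1, 2) * m ^ l * m ^ n).
Proof.
move=> He E noE.
pose D y := [set x : 'I_m | fcons (x, y) \in E].
have -> : #|E| = \sum_(y : {ffun 'I_n -> 'I_m}) #|D y|.
  rewrite -sum1_card big_mkcond (reindex _ (onW_bij _ (fcons_bij n m))) /=.
  transitivity (\sum_(p : 'I_m * {ffun 'I_n -> 'I_m})
      (fun x y => if fcons (x, y) \in E then 1 else 0) p.1 p.2).
    by apply: eq_bigr => -[].
  rewrite -(pair_bigA _ (fun x y => if fcons (x, y) \in E then 1 else 0)).
  rewrite exchange_big; apply: eq_bigr => y _; rewrite -big_mkcond -sum1_card.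
  by apply: eq_bigl => x; rewrite inE.
apply: leq_trans (power_mean _ _) _; rewrite card_ffun !card_ord leq_mul2l.
apply/orP; right.
pose S (x : {ffun 'I_l.+1 -> 'I_m}) :=
  [set y | [forall i, fcons (x i, y) \in E]].
have -> : \sum_y #|D y| ^ l.+1 = \sum_x #|S x|.
  transitivity (\sum_y \sum_x (y \in S x : nat)).
    apply: eq_bigr => y _; rewrite -[X in _ ^ X]card_ord -card_ffun_on
      -sum1_card.
    rewrite big_mkcond; apply: eq_bigr => x _.
    suff -> : (x \in ffun_on (D y)) = (y \in S x) by case: (_ \in _).
    by rewrite [RHS]inE; apply/ffun_onP/forallP => H i; have := H i;
      rewrite inE.
  rewrite exchange_big; apply: eq_bigr => x _.
  by rewrite -sum1_card [RHS]big_mkcond; apply: eq_bigr => y _; case: (_ \in _).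
rewrite (bigID (fun x : {ffun 'I_l.+1 -> 'I_m} => injectiveb x)) /=;
  apply: leq_add.
  apply: leq_trans (_ : \sum_(x : {ffun 'I_l.+1 ->
    'I_m} | injectiveb x) e <= _).
    by apply: leq_sum => x /injectiveP x_inj; apply/He/box_free_slice.
  rewrite sum_nat_const leq_mul2r -[X in _ <= X ^ _]card_ord.
  by rewrite -[X in _ <= _ ^ X]card_ord -card_ffun max_card orbT.
apply: leq_trans (_ : \sum_(x : {ffun 'I_l.+1 ->
  'I_m} | ~~ injectiveb x) m ^ n <= _).
  apply: leq_sum => x _; apply: leq_trans (max_card _) _.
  by rewrite card_ffun !card_ord.
rewrite sum_nat_const leq_mul2r; apply/orP; right.
have := ffact_deficit m l.+1; rewrite /=.
have -> : m ^ l.+1 = #|[set x : {ffun 'I_l.+1 -> 'I_m} | injectiveb x]| +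
   #|[set x : {ffun 'I_l.+1 -> 'I_m} | ~~ injectiveb x]|.
  rewrite -[X in X ^ _]card_ord -[X in _ ^ X]card_ord -card_ffun.
  rewrite -[LHS](cardsC [set x : {ffun 'I_l.+1 -> 'I_m} | injectiveb x]);
    congr addn.
  by apply: eq_card => x; rewrite !inE.
by rewrite card_inj_ffuns !card_ord leq_add2l cardsE.
Qed.

Lemma box_free_dim1 m l (E : {set {ffun 'I_1 -> 'I_m}}) :
  ~ has_box l.+1 E -> #|E| <= l.
Proof.
move=> noE; rewrite leqNgt; apply/negP => lE; apply: noE.
have lt (i : 'I_l.+1) : i < #|E| by apply: leq_trans lE.
exists (fun _ i => enum_val (Ordinal (lt i)) ord0) => [k i i' e|j].
  have /enum_val_inj [/val_inj //] : enum_val (Ordinal (lt i)) = enum_val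
    (Ordinal (lt i')).
  by apply/ffunP => k'; rewrite !(ord1 k').
suff -> : [ffun k => enum_val (Ordinal (lt (j k))) ord0] =
  enum_val (Ordinal (lt (j ord0))) by apply: enum_valP.
by apply/ffunP => k; rewrite ffunE !(ord1 k).
Qed.

End Erdos.

(** * Types over finite parameter sets *)

Section Traces.
Local Open Scope classical_set_scope.
Local Open Scope card_scope.
Context (L : language) (n lx : nat) (ly : 'I_n -> nat).
Context (phi : pformula L lx ly) (M : structure L) (m : nat).
Implicit Types (f : forall k, 'I_m -> (ly k).-tuple M) (b : lx.-tuple M).

Definition trace f b : {set {ffun 'I_n -> 'I_m}} :=
  [set j : {ffun 'I_n -> 'I_m} | `[< psat phi b (fun k => f k (j k)) >]]%SET.

(** Every finite parameter set is enumerated by injections [f k] of ['I_m]; a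
    complete type over it is then the same thing as the subset of the index
    grid cut out by one of its realisations. *)
Definition traces f : {set {set {ffun 'I_n -> 'I_m}}} :=
  [set s | `[< exists b, trace f b = s >]]%SET.

Let type_of f (s : {set {ffun 'I_n -> 'I_m}}) : set (inst ly M) :=
  [set l | exists2 j : {ffun 'I_n -> 'I_m},
     l.2 = (fun k => f k (j k)) & l.1 = (j \in s)].

Lemma inst_overE f a : (forall k, range (f k) (a k)) ->
  exists j : {ffun 'I_n -> 'I_m}, a = fun k => f k (j k).
Proof.
move=> fa; have /boolp.choice [j jP] k : exists i, f k i = a k.
  by case: (fa k) => i _ <-; exists i.
by exists (finfun j); apply/functional_extensionality_dep => k;
  rewrite ffunE jP.
Qed.

Lemma type_of_holds f b l :
  type_of f (trace f b) l -> inst_holds phi b l.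
Proof.
case: l => -[] a [j /= -> /esym] jb; rewrite /inst_holds /=.
  by move: jb; rewrite inE => /asboolP.
by move=> H; move: jb; rewrite inE => /asboolPn; apply.
Qed.

(** Over finitely many parameters a complete type is finite, so that it is
    realised; conversely the type of a realisation is maximal because a
    consistent set cannot contain an instance together with its negation. *)
Lemma complete_typesE f :
  complete_types phi (fun k => range (f k)) =
  type_of f @` [set s | s \in traces f].
Proof.
have overP b : type_of f (trace f b) `<=` inst_over (fun k => range (f k)).
  by move=> l [j lE _] k; rewrite /= lE; exists (j k).
have consP b : consistent phi (type_of f (trace f b)).
  by move=> q _ qp; exists b => l /qp; apply: type_of_holds.
apply/seteqP; split=> [p [pB pC pM]|_ [s + <-]].
  (* A function of the finite index grid enumerates all instances. *)
  have fin : finite_set p.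
    apply: (sub_finite_set pB); apply: (sub_finite_set (B :=
      (fun u : bool * {ffun 'I_n -> 'I_m} => (u.1, fun k => f k (u.2 k)))
        @` [set: bool * {ffun 'I_n -> 'I_m}])).
      by move=> [e a] /inst_overE [j /= ->]; exists (e, j).
    by apply: finite_image; apply: finite_finset.
  have [b bP] := pC p fin (fun _ => id).
  exists (trace f b); first by rewrite /= inE; apply/asboolP; exists b.
  apply: pM (overP b) (consP b) _ => -[e a] pl.
  have [j /= aE] := inst_overE (pB _ pl); exists j => //=.
  have := bP _ pl; rewrite /inst_holds inE aE /=.
  by case: e {pl} => H; rewrite ?(asboolT H) ?(asboolF H).
rewrite /= inE => /asboolP [b <-]; split=> // q qB qC pq.
apply/seteqP; split=> // -[e a] ql.
have [j /= aE] := inst_overE (qB _ ql); exists j => //=.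
have pj : type_of f (trace f b) (j \in trace f b, a) by exists j.
have [||b' b'P] := qC [set (e, a); (j \in trace f b, a)].
- by rewrite finite_setU; split; apply: finite_set1.
- by move=> _ [->//|->]; apply: pq.
have := b'P _ (or_introl erefl); have := b'P _ (or_intror erefl).
by rewrite /inst_holds /=; case: e {ql b'P} => //; case: (j \in _).
Qed.

Lemma card_complete_types f : (forall k, injective (f k)) ->
  complete_types phi (fun k => range (f k)) #= `I_#|traces f|.
Proof.
move=> f_inj; rewrite complete_typesE.
have injT : {in [set s | s \in traces f] &, injective (type_of f)}.
  move=> s t _ _ est; apply/setP => j.
  have : type_of f s (j \in s, fun k => f k (j k)) by exists j.
  rewrite est => -[j' /= ej ->]; suff -> : j = j' by [].
  apply/ffunP => k; apply: (f_inj k).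
  by have := congr1 (fun a : forall k, _ => a k) ej.
rewrite (card_eql (inj_card_eq injT)).
have inj_val : {in `I_#|traces f| &,
    injective (fun i : nat => nth finset.set0 (enum (traces f)) i)}.
  move=> i j; rewrite !inE /= cardE => ilt jlt /eqP.
  by rewrite nth_uniq ?enum_uniq // => /eqP.
apply: card_esym; rewrite -(card_eql (inj_card_eq inj_val)).
suff -> : [set s | s \in traces f] =
  [set nth finset.set0 (enum (traces f)) i | i in `I_#|traces f|] by [].
apply/seteqP; split=> [s /= sT|_ [i /= + <-]].
  exists (index s (enum (traces f))); last by rewrite nth_index // mem_enum.
  by rewrite /= cardE index_mem mem_enum.
by rewrite cardE => ilt; rewrite -mem_enum mem_nth.
Qed.

Lemma card_traces_le f : (#|traces f| <= 2 ^ (m ^ n))%N.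
Proof.
apply: leq_trans (max_card _) _.
by rewrite -cardsT -powersetT card_powerset cardsT card_ffun !card_ord.
Qed.

Lemma card_range f k : injective (f k) -> range (f k) #= `I_m.
Proof.
move=> f_inj; apply: card_eq_trans (card_esym card_II).
by apply: inj_card_eq => i j _ _; apply: f_inj.
Qed.

End Traces.

Section Pi.
Local Open Scope classical_set_scope.
Local Open Scope card_scope.
Context (L : language) (n lx : nat) (ly : 'I_n -> nat).
Context (phi : pformula L lx ly) (M : structure L) (m : nat).

Lemma enum_card_set (T : Type) (B : set T) : B #= `I_m ->
  exists2 f : 'I_m -> T, injective f & range f = B.
Proof.
move=> /card_esym/card_bijP [g [h gK hK]].
have memI (i : 'I_m) : val i \in `I_m by rewrite inE /=.
exists (fun i => \val (g (SigSub (memI i)))) => [i j /val_inj/(can_inj gK)|].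
  by move=> /(congr1 val) /= /val_inj.
apply/seteqP; split=> [_ [i _ <-]|t Bt]; first exact: set_valP.
have ltm : (val (h (SigSub (mem_set Bt))) < m)%N by have :=
  set_valP (h (SigSub (mem_set Bt))).
exists (Ordinal ltm) => //=.
by rewrite (_ : SigSub _ = h (SigSub (mem_set Bt))) ?hK //; apply: val_inj.
Qed.

Let counts := [set c | exists B : forall k, set ((ly k).-tuple M),
    (forall k, B k #= `I_m) /\ complete_types phi B #= `I_c].

Lemma countsP c : counts c <->
  exists2 f : forall k, 'I_m -> (ly k).-tuple M,
    (forall k, injective (f k)) & c = #|traces phi f|.
Proof.
split=> [[B [Bm Bc]]|[f f_inj ->]]; last first.
  exists (fun k => range (f k)); split; last exact: card_complete_types.
  by move=> k; apply: card_range.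
have fP k := cid2 (enum_card_set (Bm k)).
exists (fun k => s2val (fP k)) => [k|]; first exact: (s2valP (fP k)).
have BE : B = fun k => range (s2val (fP k)).
  by apply/functional_extensionality_dep => k; rewrite (s2valP' (fP k)).
apply/card_eq_II; rewrite -(card_eql Bc) [X in complete_types _ X]BE.
by apply: card_complete_types => k; apply: (s2valP (fP k)).
Qed.

(** The supremum defining [pi_phi] is bounded by the number of subsets of the
    grid, hence not the default value of an unbounded set. *)
Lemma pi_phi_ge (f : forall k, 'I_m -> (ly k).-tuple M) :
  (forall k, injective (f k)) -> (#|traces phi f| <= pi_phi M phi m)%N.
Proof.
move=> f_inj; apply: (@ge_supremum_Nmem _ _ 0%N counts); last first.
  by apply/countsP; exists f.
apply: nat_supremums_neq0; exists (2 ^ (m ^ n))%N => c /countsP[g _ ->].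
exact: card_traces_le.
Qed.

Lemma pi_phi_le K :
  (forall f : forall k, 'I_m -> (ly k).-tuple M,
    (forall k, injective (f k)) -> #|traces phi f| <= K)%N ->
  (pi_phi M phi m <= K)%N.
Proof.
move=> leK; have ubK : ubound counts K by move=> c /countsP[f fi ->];
  apply: leK.
rewrite /pi_phi /supremum; case: ifP => // _.
have [x xS] : supremums counts !=set0 by apply: nat_supremums_neq0; exists K.
case: xgetP => [y -> [_ ylb]|/(_ x)//]; exact: ylb.
Qed.

End Pi.

(** * The upper bounds *)

Section DimBound.
Import mathcomp.boot.fintype mathcomp.boot.finset.
Context (L : language) (n lx : nat) (ly : 'I_n -> nat).
Context (phi : pformula L lx ly) (M : structure L).

(** Restricting the parameters to a box inside a shattered set realises every
    subset of a smaller grid. *)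
Lemma shattered_box_pi m l (f : forall k, 'I_m -> (ly k).-tuple M) S :
  (forall k, injective (f k)) -> shattered (traces phi f) S -> has_box l S ->
  (2 ^ (l ^ n) <= pi_phi M phi l)%N.
Proof.
move=> f_inj /shatteredP Ssh [g g_inj gS].
pose h k i := f k (g k i).
pose G (j : {ffun 'I_n -> 'I_l}) := [ffun k => g k (j k)].
have G_inj : injective G.
  by move=> j j' /ffunP e; apply/ffunP => k; have := e k;
    rewrite !ffunE => /g_inj.
have h_inj k : injective (h k) by move=> i i' /f_inj/g_inj.
apply: leq_trans (pi_phi_ge phi h_inj).
suff -> : traces phi h = setT.
  by rewrite -powersetT card_powerset cardsT card_ffun !card_ord.
apply/setP => s; rewrite !inE; apply/asboolP.
have [|B] := Ssh (G @: s); first by apply/subsetP => _ /imsetP[j _ ->];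
  apply: gS.
rewrite inE => /asboolP[b <-] /setP sE; exists b; apply/setP => j.
have := sE (G j); rewrite mem_imset // !inE gS andbT => <-.
by congr (`[< psat _ _ _ >]); apply: functional_extensionality_dep => k;
  rewrite ffunE.
Qed.

(** With more types, a set of at least [zarankiewicz n m d.+1] index tuples
    would be shattered; seen as a hypergraph it contains a box of side
    [d.+1], and [pi_phi] would reach its maximal value at [d.+1], beyond the
    dimension. *)
Lemma pi_phi_zarankiewicz d m : dim_le M phi d ->
  (pi_phi M phi m <= \sum_(i < zarankiewicz n m d.+1) 'C(m ^ n, i))%N.
Proof.
move=> [d0 [_ dlt] d0d]; apply: pi_phi_le => f f_inj.
rewrite leqNgt; apply/negP => ltF.
have [|S Ssh zS] := @sauer_shelah _ (traces phi f) (zarankiewicz n m d.+1).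
  by rewrite card_ffun !card_ord.
have := shattered_box_pi f_inj Ssh (zarankiewicz_has_box (ltn0Sn d) zS).
by rewrite leqNgt dlt.
Qed.

End DimBound.

Section Bounds.
Import mathcomp.boot.fintype mathcomp.boot.finset.

Lemma zarankiewicz1 n m : (zarankiewicz n m 1 <= 1)%N.
Proof.
apply: zarankiewicz_le => E; rewrite card_gt0 => /set0Pn[y yE].
exists (fun k _ => y k) => [k i i' _|j]; first by rewrite !ord1.
by rewrite (_ : finfun _ = y) //; apply/ffunP => k; rewrite ffunE.
Qed.

Lemma zarankiewicz_dim1 m l : (zarankiewicz 1 m l.+1 <= l.+1)%N.
Proof.
apply: zarankiewicz_le => E lE; apply: contrapT => /box_free_dim1.
by rewrite leqNgt lE.
Qed.

Lemma sum_bin_le N z : (2 <= N)%N -> (\sum_(i < z) 'C(N, i) <= N ^ z)%N.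
Proof.
move=> N2; elim: z => [|z IH]; first by rewrite big_ord0.
rewrite big_ord_recr /= expnS; apply: leq_trans (leq_mul N2 (leqnn _)).
rewrite mul2n -addnn leq_add //; apply: leq_trans (ffact_le_exp N z).
by rewrite -bin_ffact leq_pmulr // fact_gt0.
Qed.

Context (R : realType).

(** One unit of dimension divides the gain [eps] in the exponent by [l.+1]; the
    hypothesis on [K] keeps the leading constant equal to [2] at each step. *)
Lemma box_free_real_step n m l (K eps : R) : (0 < m)%N ->
  0 <= K -> K + 'C(l.+1, 2)%:R <= 2 ^+ l.+1 -> eps <= 1 ->
  (forall E : {set {ffun 'I_n -> 'I_m}}, ~ has_box l.+1 E ->
    #|E|%:R <= K * m%:R `^ (n%:R - eps)) ->
  forall E : {set {ffun 'I_n.+1 -> 'I_m}}, ~ has_box l.+1 E ->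
    #|E|%:R <= 2 * m%:R `^ (n.+1%:R - eps / l.+1%:R) :> R.
Proof.
move=> m0 K0 KC eps1 He E noE.
set b := K * _ in He; have b0 : 0 <= b by rewrite mulr_ge0 // powR_ge0.
have m1 : 1 <= m%:R :> R by rewrite ler1n.
have mn0 : m%:R != 0 :> R by rewrite pnatr_eq0 -lt0n.
have He' (E' : {set {ffun 'I_n -> 'I_m}}) : ~ has_box l.+1 E' ->
  (#|E'| <= Num.truncn b)%N.
  by move=> noE'; rewrite truncn_ge_nat // He.
have := box_free_step He' noE; move: 'C(l.+1, 2) KC => C KC.
rewrite -(ler_nat R) !(natrX, natrM, natrD) => step.
rewrite -(@ler_pXn2r _ l.+1) ?nnegrE // ?mulr_ge0 ?powR_ge0 //.
apply: le_trans step _; rewrite exprMn.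
rewrite -[X in _ <= _ * X]powR_mulrn ?powR_ge0 //.
rewrite -powRrM mulrBl divfK ?pnatr_eq0 //.
have -> : n.+1%:R * l.+1%:R - eps = n%:R * l%:R + l.+1%:R + (n%:R - eps) :> R.
  by rewrite -!natr1; ring.
rewrite 2?powRD ?mn0 ?implybT // -[n%:R * _]natrM !powR_mulrn //.
set X := m%:R; set P := _ `^ (n%:R - eps).
have XnE : X ^+ n = X * X `^ (n%:R - 1).
  by rewrite powRB ?mn0 ?implybT // powRr1 // powR_mulrn // mulrC mulfVK.
rewrite [X in _ + _ * X]XnE -exprM.
have -> : X ^+ (n * l) * (X ^+ l.+1 * (Num.truncn b)%:R +
    C%:R * X ^+ l * (X * X `^ (n%:R - 1))) =
  X ^+ (n * l) * X ^+ l.+1 * ((Num.truncn b)%:R + C%:R * X `^ (n%:R - 1)).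
  by rewrite [X ^+ l.+1]exprS; ring.
rewrite mulrCA ler_pM2l ?mulr_gt0 ?exprn_gt0 ?ltr0n //.
apply: le_trans (_ : K * P + C%:R * P <= _); last first.
  by rewrite -mulrDl ler_wpM2r // powR_ge0.
rewrite lerD // ?truncn_le //.
by rewrite ler_wpM2l // ler_powR // lerB.
Qed.

Lemma bin2_le_exp2 l :
  (2 + 'C(l.+1, 2) <= 2 ^ l.+1)%N /\ (l + 'C(l.+1, 2) <= 2 ^ l.+1)%N.
Proof.
elim: l => // l [IH1 IH2]; rewrite binS bin1.
have := ltn_expl l.+1 (isT : 1 < 2)%N; rewrite (expnS 2 l.+1); lia.
Qed.

(** Erdos's bound, starting from [box_free_dim1], where the gain is [1] and the
    constant is [l]. *)
Lemma box_free_bound n m l (E : {set {ffun 'I_n.+2 -> 'I_m}}) : (0 < m)%N ->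
  ~ has_box l.+1 E ->
  #|E|%:R <= 2 * m%:R `^ (n.+2%:R - 1 / l.+1%:R ^+ n.+1) :> R.
Proof.
move=> m0; have [le2 lel] := bin2_le_exp2 l.
elim: n E => [|n IH] E.
  rewrite expr1; apply: (@box_free_real_step 1 m l l%:R) => //.
    by rewrite -natrD -natrX ler_nat.
  by move=> E' /box_free_dim1; rewrite subrr powRr0 mulr1 ler_nat.
have -> : 1 / l.+1%:R ^+ n.+2 = 1 / l.+1%:R ^+ n.+1 / l.+1%:R :> R.
  by rewrite !div1r exprSr invfM.
apply: box_free_real_step IH E => //.
  by rewrite -natrD -natrX ler_nat.
by rewrite div1r invf_le1 ?exprn_gt0 ?ltr0n // exprn_ege1 // ler1n.
Qed.

Lemma zarankiewicz_bound_real n m l : (0 < m)%N ->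
  (zarankiewicz n.+2 m l.+1)%:R <=
    2 * m%:R `^ (n.+2%:R - 1 / l.+1%:R ^+ n.+1) + 1 :> R.
Proof.
move=> m0; set x := 2 * _; have x0 : 0 <= x by rewrite mulr_ge0 // powR_ge0.
apply: le_trans (_ : (Num.truncn x).+1%:R <= _).
  rewrite ler_nat; apply: zarankiewicz_le => E xE; apply: contrapT => noE.
  by move: xE; rewrite ltnNge truncn_ge_nat // box_free_bound.
by rewrite -natr1 lerD2r truncn_le.
Qed.

Lemma powR2_log2 (a x : R) : 0 < x -> 2 `^ (a * log2 x) = x `^ a.
Proof.
move=> x0; rewrite /powR !gt_eqF //.
by rewrite /log2 -mulrA mulfVK // gt_eqF // ln_gt0 // ltr1n.
Qed.

Lemma log2_ge0 (m : nat) : (0 < m)%N -> 0 <= log2 m%:R :> R.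
Proof. by move=> m0; rewrite divr_ge0 ?ln_ge0 ?ler1n. Qed.

(** Logarithms are dominated by powers: use [ln x < x] at [x = m `^ (a / 2)]. *)
Lemma log2_little_o (A a : R) : 0 <= A -> 0 < a ->
  exists m0 : nat, forall m : nat, (m0 <= m)%N -> A * log2 m%:R <= m%:R `^ a.
Proof.
move=> A0 a0; have l2 : 0 < ln 2 :> R by rewrite ln_gt0 // ltr1n.
pose B := A / ln 2 * (2 / a).
have B0 : 0 <= B by rewrite !mulr_ge0 ?invr_ge0 // ltW.
exists (Num.truncn (B `^ (2 / a))).+1 => m mB.
have Bm : B `^ (2 / a) <= m%:R.
  by apply: ltW; apply: lt_le_trans (truncnS_gt _) _; rewrite ler_nat.
have m0 : 0 < m%:R :> R by rewrite ltr0n; lia.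
have xP : 0 < m%:R `^ (a / 2) :> R by rewrite powR_gt0.
have BX : B <= m%:R `^ (a / 2).
  have := @ge0_ler_powR R (a / 2) _ _ _ _ _ Bm.
  rewrite -powRrM (_ : 2 / a * (a / 2) = 1) ?powRr1 //; last by field; lra.
  by apply; rewrite ?nnegrE ?powR_ge0 //; lra.
have -> : m%:R `^ a = m%:R `^ (a / 2) * m%:R `^ (a / 2).
  rewrite -powRD ?(gt_eqF m0) ?implybT //; congr (_ `^ _); lra.
apply: le_trans (_ : B * m%:R `^ (a / 2) <= _); last by rewrite ler_pM2r.
have -> : A * log2 m%:R = B * ln (m%:R `^ (a / 2)).
  by rewrite ln_powR /B /log2; field; rewrite !gt_eqF.
by rewrite ler_wpM2l // ltW // ln_sublinear.
Qed.

Lemma sum_bin_le_powR n m z : (0 < n)%N -> (2 <= m)%N ->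
  (\sum_(i < z) 'C(m ^ n, i))%:R <= 2 `^ (n%:R * z%:R * log2 m%:R) :> R.
Proof.
move=> n0 m2; have m0 : 0 < m%:R :> R by rewrite ltr0n; lia.
rewrite powR2_log2 // -natrM powR_mulrn ?(ltW m0) // -natrX ler_nat expnM.
by apply: sum_bin_le; apply: leq_trans (m2) _; rewrite -{1}(expn1 m) leq_exp2l.
Qed.

(** The constant [5 / 2] absorbs the rounding: [2 * x + 1 <= 5 / 2 * x] once
    [2 <= x]. *)
Lemma const_ge n (eps : R) : eps <= 1 / 2 ->
  5 / 2 <= n.+2%:R `^ (n.+2%:R - eps).
Proof.
move=> eps2; have n2 : 2 <= n.+2%:R :> R by rewrite ler_nat.
apply: le_trans (_ : n.+2%:R `^ (3 / 2) <= _); last first.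
  by rewrite ler_powR //; lra.
rewrite -(@ler_pXn2r _ 2) ?nnegrE ?powR_ge0 //; last lra.
rewrite -[leRHS]powR_mulrn ?powR_ge0 // -powRrM.
rewrite (_ : 3 / 2 * 2%:R = 3%:R :> R); last lra.
rewrite powR_mulrn //; apply: le_trans (_ : 2 ^+ 3 <= _); first lra.
by rewrite lerXn2r ?nnegrE.
Qed.

Lemma asymptotic_bound n d m (eps : R) (c := n%:R `^ (n%:R + 1 - eps)) :
  eps = 1 / d.+1%:R ^+ (n - 1) ->
  (1 <= n)%N -> (2 <= m)%N -> (2 <= n)%N \/ d = 0%N ->
  (\sum_(i < zarankiewicz n m d.+1) 'C(m ^ n, i))%:R <=
    2 `^ (c * m%:R `^ (n%:R - eps) * log2 m%:R) :> R.
Proof.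
move=> epsE n1 m2 nd; have m0 : (0 < m)%N by lia.
have lm := log2_ge0 m0.
(* For [d = 0] the gain is [1], too large for [const_ge], but then a single
   edge is already a box. *)
case: d nd epsE => [_ _|d nd epsE].
  apply: (@le_trans _ _ 1).
    rewrite lern1; case: (zarankiewicz n m 1) (zarankiewicz1 n m) => [|[|//]] _.
      by rewrite big_ord0.
    by rewrite big_ord1 bin0.
  rewrite -[leLHS](powRr0 (2 : R)) ler_powR ?ler1n //.
  by apply: mulr_ge0 => //; apply: mulr_ge0; apply: powR_ge0.
case: nd => // n2; apply: le_trans (sum_bin_le_powR _ n1 m2) _.
rewrite ler_powR ?ler1n // ler_wpM2r //.
case: n n1 n2 @c epsE => [//|[//|n]] _ _ c; rewrite subn1 /= => epsE.
have d2 : eps <= 1 / 2.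
  rewrite epsE !div1r lef_pV2 ?posrE ?exprn_gt0 ?ltr0n //.
  rewrite exprS; apply: le_trans (_ : d.+2%:R * 1 <= _);
    first by rewrite mulr1 ler_nat.
  by rewrite ler_wpM2l // exprn_ege1 // ler1n.
have nn : n.+2%:R != 0 :> R by rewrite pnatr_eq0.
have -> : c = n.+2%:R * n.+2%:R `^ (n.+2%:R - eps).
  rewrite /c (_ : _ + 1 - eps = 1 + (n.+2%:R - eps)); last by ring.
  by rewrite powRD ?nn ?implybT // powRr1.
rewrite -mulrA ler_pM2l ?ltr0n //.
apply: le_trans (zarankiewicz_bound_real _ _ m0) _; rewrite -epsE.
have x2 : 2 <= m%:R `^ (n.+2%:R - eps).
  apply: le_trans (_ : m%:R `^ 1 <= _); first by rewrite powRr1 // ler_nat.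
  rewrite ler_powR ?ler1n //; have : 2 <= n.+2%:R :> R by rewrite ler_nat.
  lra.
have := const_ge n d2; nra.
Qed.

End Bounds.

(** * Dense graphs without K22 *)

Section IncidenceGraph.
Import mathcomp.boot.fintype mathcomp.boot.finset.

Definition K22_free (P Q : finType) (E : {set P * Q}) : Prop :=
  forall p p' q q', (p, q) \in E -> (p, q') \in E -> (p', q) \in E ->
    (p', q') \in E -> p = p' \/ q = q'.

(** A point (x, y) of the affine plane and a non-vertical line y = a x + b. *)
Definition incidence (F : finFieldType) : {set (F * F) * (F * F)} :=
  [set u | u.1.2 == u.2.1 * u.1.1 + u.2.2].

Lemma K22_free_incidence (F : finFieldType) : K22_free (incidence F).
Proof.
move=> [x y] [x' y'] [a b] [a' b'];
  rewrite !inE /= => /eqP e1 /eqP e2 /eqP e3 /eqP e4.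
have : (a - a') * (x - x') = 0.
  rewrite (_ : _ * _ =
    (a * x + b - (a' * x + b')) - (a * x' + b - (a' * x' + b'))).
    by rewrite -e1 -e2 -e3 -e4 !subrr.
  by ring.
move/eqP; rewrite mulf_eq0 !subr_eq0 => /orP[/eqP ea|/eqP ex]; [right|left].
  by congr pair => //; apply: (addrI (a * x)); rewrite -e1 ea -e2.
by congr pair => //; rewrite e1 e3 ex.
Qed.

Lemma card_incidence (F : finFieldType) : #|incidence F| = (#|F| ^ 3)%N.
Proof.
have <- : #|{: F * (F * F)}| = (#|F| ^ 3)%N by rewrite !card_prod !expnS muln1.
rewrite -(card_imset (f := fun v : F * (F * F) =>
  ((v.1, v.2.1 * v.1 + v.2.2), v.2))).
  apply: eq_card => -[[x y] [a b]]; rewrite inE /=.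
  by apply/eqP/imsetP => [->|[[x' [a' b']] _ [-> -> -> ->]]//];
    exists (x, (a, b)).
by move=> [x [a b]] [x' [a' b']] /= [-> _ -> ->].
Qed.

(** Take the largest [k] with [4 ^ k <= m] and place the incidence graph of the
    plane over the field with [q = 2 ^ k] elements on [q ^ 2] vertices of each
    side.  It has [q ^ 3] edges and [m < 4 * q ^ 2], whence the factor [64].
    For [0 < m < 4] one edge suffices. *)
Lemma K22_free_large m :
  exists2 E : {set 'I_m * 'I_m}, K22_free E & (m ^ 3 <= 64 * #|E| ^ 2)%N.
Proof.
have [m4|m4] := leqP 4 m; last first.
  case: m m4 => [|m] m4; first by exists set0 => // p p' q q'; rewrite inE.
  exists [set (ord0, ord0)]; first by move=> p p' q q' /set1P[-> _] _ /set1P[->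
    _] _; left.
  by rewrite cards1; move: m m4 => [|[|[|]]].
pose k := trunc_log 4 m.
have k0 : (0 < k)%N by rewrite trunc_log_gt0.
have km : (4 ^ k <= m)%N by apply: trunc_logP => //; lia.
have mk : (m < 4 ^ k.+1)%N by apply: trunc_log_ltn.
have [F _ cF] := pPrimePowerField (isT : prime 2) k0.
have cFF : #|{: F * F}| = (4 ^ k)%N by rewrite card_prod cF -expnMn.
have le : (#|{: F * F}| <= m)%N by rewrite cFF.
have [i i_inj] : exists i : F * F -> 'I_m, injective i.
  exists (fun u => widen_ord le (enum_rank u)).
  by move=> u v /(congr1 val) /= /val_inj/enum_rank_inj.
have ii_inj : injective (fun u : (F * F) * (F * F) => (i u.1, i u.2)).
  by move=> [u v] [u' v'] [/i_inj /= -> /i_inj /= ->].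
exists [set (i u.1, i u.2) | u in incidence F].
  move=> x x' y y' /imsetP[[p q] pq [-> ->]] /imsetP[[p0 q'] pq' [/i_inj /= p0E
    ->]].
  move=> /imsetP[[p' q0] p'q [-> /i_inj /= q0E]].
  move=> /imsetP[[p1 q1] p'q' [/i_inj /= p1E /i_inj /= q1E]].
  move: pq' p'q p'q'; rewrite -p0E -q0E -p1E -q1E => pq' p'q p'q'.
  by have [<-|<-] := K22_free_incidence pq pq' p'q p'q'; [left|right].
rewrite card_imset // card_incidence cF -!expnM.
have -> : (64 * 2 ^ (k * (3 * 2)) = (4 ^ k.+1) ^ 3)%N.
  rewrite -expnM (_ : 64 = 2 ^ 6)%N // -expnD (_ : 4 = 2 ^ 2)%N // -expnM.
  by congr expn; lia.
by rewrite leq_exp2r // ltnW.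
Qed.

End IncidenceGraph.

Definition triple (A : Type) (x y z : A) (i : 'I_3) : A :=
  match val i with 0%N => x | 1%N => y | _ => z end.

(** An element is a vertex [inl (m, i)], which can serve on either side of a
    graph of size [m], or a code [inr s] of a set [s] of pairs of indices. *)
Definition universe : Type := (nat * nat) + (nat -> nat -> Prop).

(** A constant for each element of the intended structure: all the
    configurations needed for the lower bound are then expressed by atomic
    sentences and pass to every model of its theory. *)
Definition graph_language : language :=
  @Language universe (fun=> 0%N) unit (fun=> 3%N).

Definition const (V : Type) (c : universe) : term graph_language V :=
  @App graph_language V c (fun i : 'I_0 => False_rect _ (notF (ltn_ord i))).

Definition relF (V : Type) (x y z : term graph_language V) :
    formula graph_language V :=
  @Rel graph_language V tt (triple x y z).

Section Semantics.
Context (N : structure graph_language).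

Definition incident (x y z : N) : Prop :=
  @rel_int _ N tt [tuple triple x y z i | i < 3].

Definition cst (c : universe) : N := @fun_int _ N c [tuple].

Lemma eval_const V (e : V -> N) c : eval e (const V c) = cst c.
Proof. by rewrite /= /cst; congr fun_int; apply: tuple0. Qed.

Lemma sat_relF V (e : V -> N) x y z :
  sat (relF x y z) e = incident (eval e x) (eval e y) (eval e z).
Proof.
rewrite /= /incident; congr rel_int; apply: eq_from_tnth => i;
  rewrite !tnth_mktuple.
by case: i => -[|[|[|]]].
Qed.
End Semantics.

Definition neg (V : Type) (p : formula graph_language V) := Imp p (Bot _ V).

Definition K22_free_sentence : sentence graph_language :=
  let b := Var graph_language (Some (Some (Some (Some None)))) in
  let p := Var graph_language (Some (Some (Some None))) in
  let p' := Var graph_language (Some (Some None)) in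
  let q := Var graph_language (Some None) in
  let q' := Var graph_language None in
  All (All (All (All (All
    (Imp (relF b p q) (Imp (relF b p q') (Imp (relF b p' q) (Imp (relF b p' q')
      (Imp (neg (Eq p p')) (Eq q q')))))))))).

Lemma holds_K22_free N : holds N K22_free_sentence <->
  forall b p p' q q' : N, incident b p q -> incident b p q' ->
    incident b p' q -> incident b p' q' ->
    p = p' \/ q = q'.
Proof.
rewrite /holds /K22_free_sentence; cbv zeta; cbn [sat neg].
split=> H b p p' q q'; last first.
  rewrite !sat_relF => h1 h2 h3 h4 pp'.
  by have [/pp'[]|] := H _ _ _ _ _ h1 h2 h3 h4.
move=> h1 h2 h3 h4; have [|pp'] := pselect (p = p'); [by left|right].
by have := H b p p' q q'; rewrite !sat_relF; apply.
Qed.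

(** * A 2-dependent formula with many types *)

Definition large_graph (m : nat) : {set 'I_m * 'I_m} :=
  s2val (cid2 (K22_free_large m)).

Lemma large_graph_K22_free m : K22_free (large_graph m).
Proof. exact: (s2valP (cid2 (K22_free_large m))). Qed.

Lemma card_large_graph m : (m ^ 3 <= 64 * #|large_graph m| ^ 2)%N.
Proof. exact: (s2valP' (cid2 (K22_free_large m))). Qed.

(** The code [s] is related to the edges of the [K22_free] graphs that belong to
    [s]; hence each single code spans a [K22_free] graph, while every set of
    edges of [large_graph m] is cut out by a code. *)
Definition universe_rel (b x y : universe) : Prop :=
  match b, x, y with
  | inr s, inl (m, i), inl (m', j) =>
      [/\ m = m', exists2 e, e \in large_graph m & (val e.1, val e.2) = (i, j)
        & s i j]
  | _, _, _ => False
  end.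

Definition graph_structure : structure graph_language :=
  @Structure graph_language universe (inl (0, 0)%N) (fun c _ => c)
    (fun _ t =>
      universe_rel (tnth t ord0) (tnth t (lift ord0 ord0)) (tnth t ord_max)).

Definition graph_theory : theory graph_language := holds graph_structure.

Lemma incident_graph_structure (b x y : graph_structure) :
  incident b x y = universe_rel b x y.
Proof. by rewrite /incident /= !tnth_mktuple. Qed.

Lemma graph_theory_models : models graph_structure graph_theory.
Proof. by []. Qed.

Lemma graph_theory_complete : complete_theory graph_theory.
Proof.
split=> [|s]; first by exists graph_structure; apply: graph_theory_models.
have [Hs|Hs] := pselect (holds graph_structure s); [left|right] => N NT.
  exact: NT.
by move=> Ns; have /NT/(_ Ns) : graph_theory (neg s) by [].
Qed.

Lemma graph_structure_K22_free (b p p' q q' : graph_structure) :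
  incident b p q -> incident b p q' -> incident b p' q -> incident b p' q' ->
    p = p' \/ q = q'.
Proof.
rewrite !incident_graph_structure; case: b => // s.
case: p p' q q' => [[m i]|//] [[m1 i']|//] [[m2 j]|//] [[m3 j']|//] /=.
move=> [<- {m2} [[e1 f1] E1 [/= <- <-]] _] [<- {m3} [[e2 f2] E2 [/= e21 <-]] _].
move=> [-> {m1} [[e3 f3] E3 [/= <- e31]] _] [_ [[e4 f4] E4 [/= e41 f41]] _].
have ? := val_inj e21; have ? := val_inj e31; have ? := val_inj e41.
have ? := val_inj f41; subst.
by have [->|->] := large_graph_K22_free E1 E2 E3 E4; [left|right].
Qed.

Section Models.
Context (N : structure graph_language).
Context (NT : models N graph_theory).

Lemma model_K22_free (b p p' q q' : N) :
  incident b p q -> incident b p q' -> incident b p' q -> incident b p' q' ->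
    p = p' \/ q = q'.
Proof.
move: b p p' q q'; apply/holds_K22_free/NT/holds_K22_free.
exact: graph_structure_K22_free.
Qed.

Lemma cst_inj : injective (cst N).
Proof.
move=> c c' e; apply: contrapT => cc'.
have : holds graph_structure (neg (Eq (const void c) (const void c'))) by [].
by move=> /NT; apply; cbn [sat]; rewrite !eval_const.
Qed.

Lemma incident_cst b x y : incident (cst N b) (cst N x) (cst N y) <->
  universe_rel b x y.
Proof.
have NE : holds N (relF (const void b) (const void x) (const void y)) <->
    incident (cst N b) (cst N x) (cst N y).
  by rewrite /holds sat_relF !eval_const.
have ME : holds graph_structure
    (relF (const void b) (const void x) (const void y)) <-> universe_rel b x y.
  by rewrite /holds sat_relF !eval_const incident_graph_structure.
split=> [r|/ME/NT/NE//]; apply: contrapT => nr.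
have : holds graph_structure
    (neg (relF (const void b) (const void x) (const void y))).
  by move=> /ME.
by move/NT; apply; apply/NE.
Qed.

End Models.

Definition edge_formula : pformula graph_language 1 (fun _ : 'I_2 => 1%N) :=
  relF (Var _ (inl ord0))
    (Var _ (inr (existT (fun=> 'I_1) (ord0 : 'I_2) ord0)))
    (Var _ (inr (existT (fun=> 'I_1) (ord_max : 'I_2) ord0))).

Lemma psat_edge_formula (N : structure graph_language) b a :
  @psat _ _ _ _ N edge_formula b a =
  incident (thead b) (thead (a ord0)) (thead (a ord_max)).
Proof. by rewrite /psat /edge_formula sat_relF. Qed.

(** Independence would provide an element related to all pairs of parameters, so
    that two parameters of the same side coincide, and another one related to a
    single pair, which separates them. *)
Lemma edge_formula_n_dependent : n_dependent graph_theory edge_formula.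
Proof.
move=> [N [NT [a aP]]].
pose v i j : 2.-tuple nat := [tuple i; j].
have aE s : exists b : 1.-tuple N, forall i j,
    incident (thead b) (thead (a ord0 i)) (thead (a ord_max j)) <-> s i j.
  have [b bP] := aP (fun t => s (tnth t ord0) (tnth t ord_max)).
  by exists b => i j; have := bP (v i j); rewrite psat_edge_formula.
have [b bP] := aE (fun _ _ => True).
have [b' b'P] := aE (fun i j => i = 0%N /\ j = 0%N).
have r00 := (b'P 0%N 0%N).2 (conj erefl erefl).
have [e|e] : thead (a ord0 0%N) = thead (a ord0 1%N) \/
    thead (a ord_max 0%N) = thead (a ord_max 1%N).
  by apply: (model_K22_free NT); apply/bP.
  by move: r00; rewrite e => /b'P[].
by move: r00; rewrite e => /b'P[].
Qed.

Lemma pi_edge_formula_ge (N : structure graph_language) m :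
  models N graph_theory -> (2 ^ #|large_graph m| <= pi_phi N edge_formula m)%N.
Proof.
move=> NT; pose f (k : 'I_2) (i : 'I_m) := [tuple cst N (inl (m, val i))].
have f_inj k : injective (f k).
  by move=> i j [/(cst_inj NT)[/val_inj]].
apply: leq_trans (pi_phi_ge edge_formula f_inj).
pose h (s : {set 'I_m * 'I_m}) : {set {ffun 'I_2 -> 'I_m}} :=
  [set j : {ffun 'I_2 -> 'I_m} | (j ord0, j ord_max) \in s]%SET.
have h_inj : injective h.
  move=> s t /setP e; apply/setP => -[x y].
  have := e [ffun k => if k == ord0 then x else y].
  by rewrite !inE !ffunE.
rewrite -card_powerset -(card_imset _ h_inj).
apply: subset_leq_card; apply/fintype.subsetP => _ /imsetP[s + ->].
rewrite inE => /fintype.subsetP sE; rewrite inE; apply/asboolP.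
exists [tuple cst N (inr (fun x y =>
  exists2 e, e \in s & (val e.1, val e.2) = (x, y)))].
apply/setP => j; rewrite !inE psat_edge_formula; apply/asboolP/idP.
  move=> /(incident_cst NT)[_ _ [[x y] xy [/val_inj <- /val_inj <-]]] //.
by move=> js; apply/(incident_cst NT); split=> //;
  exists (j ord0, j ord_max) => //; apply: sE.
Qed.

Lemma pow2_three_halves_le (R : realType) m E : (m ^ 3 <= 64 * E ^ 2)%N ->
  2 `^ (1 / 8 * m%:R `^ (3 / 2)) <= (2 ^ E)%:R :> R.
Proof.
move=> mE; rewrite natrX -powR_mulrn // ler_powR ?ler1n //.
have : m%:R `^ (3 / 2) <= 8 * E%:R :> R; last lra.
rewrite -(@ler_pXn2r _ 2) ?nnegrE ?powR_ge0 ?mulr_ge0 //.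
rewrite -[leLHS]powR_mulrn ?powR_ge0 // -powRrM.
rewrite (_ : 3 / 2 * 2%:R = 3%:R :> R); last lra.
rewrite powR_mulrn // -natrX -natrM -natrX ler_nat; apply: leq_trans mE _.
by rewrite expnMn.
Qed.

(** * The theorem *)

Theorem theorem3p12 (R : realType) :
  (forall n d : nat, (1 <= n)%N ->
    let eps : R := 1 / d.+1%:R ^+ (n - 1) in
    let c : R := n%:R `^ (n%:R + 1 - eps) in
    (forall (L : language) (T : theory L) (lx : nat) (ly : 'I_n -> nat)
        (phi : pformula L lx ly) (M : structure L),
      models M T -> n_dependent T phi -> dim_le M phi d ->
      forall m : nat, (d <= m)%N ->
      (pi_phi M phi m <=
         \sum_(i < zarankiewicz n m d.+1) 'C(m ^ n, i))%N) /\
    (exists (eps0 : R) (m0 : nat), 0 < eps0 /\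
      forall eps' : R, 0 < eps' <= eps0 ->
      forall (L : language) (T : theory L) (lx : nat) (ly : 'I_n -> nat)
        (phi : pformula L lx ly) (M : structure L),
      models M T -> n_dependent T phi -> dim_le M phi d ->
      forall m : nat, (m0 <= m)%N ->
      [/\ (2 <= n)%N \/ d = 0%N ->
          (pi_phi M phi m)%:R <=
            2 `^ (c * m%:R `^ (n%:R - eps) * log2 m%:R) :> R,
          2 `^ (c * m%:R `^ (n%:R - eps) * log2 m%:R) <=
            2 `^ (m%:R `^ (n%:R - eps')) :> R &
          (pi_phi M phi m)%:R <= 2 `^ (m%:R `^ (n%:R - eps')) :> R])) /\
  (exists (c : R) (L : language) (T : theory L) (lx : nat) (ly : 'I_2 -> nat)
      (phi : pformula L lx ly),
    [/\ 0 < c, complete_theory T, n_dependent T phi &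
      forall M : structure L, models M T ->
      forall m : nat, 2 `^ (c * m%:R `^ (3 / 2)) <= (pi_phi M phi m)%:R :> R]).
Proof.
split; last first.
  exists (1 / 8), graph_language, graph_theory, 1%N, (fun=> 1%N), edge_formula.
  split; [lra | exact: graph_theory_complete
         | exact: edge_formula_n_dependent |].
  move=> M MT m; apply: le_trans (pow2_three_halves_le R (card_large_graph m))
    _.
  by rewrite ler_nat pi_edge_formula_ge.
move=> n d n1 eps c; split.
  by move=> L T lx ly phi M _ _ dimd m _; apply: pi_phi_zarankiewicz.
have eps0 : 0 < eps by rewrite divr_gt0 // exprn_gt0 // ltr0n.
have c0 : 0 <= c by apply: powR_ge0.
(* Half of the gain absorbs the logarithm; the exponent [1 / 2] serves the case
   [n = 1], where [eps = 1]. *)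
have eps2 : 0 < eps / 2 by lra.
have half : 0 < 1 / 2 :> R by lra.
have [m1 m1P] := log2_little_o c0 eps2.
have [m2 m2P] := log2_little_o (ler0n R d.+1) half.
exists (eps / 2), (maxn 2 (maxn m1 m2)); split; first by rewrite divr_gt0.
move=> eps' /andP[eps'0 eps'2] L T lx ly phi M _ _ dimd m.
rewrite !geq_max => /and3P[le2m /m1P logc /m2P logd].
have m_ge1 : 1 <= m%:R :> R by rewrite ler1n (ltnW le2m).
have m_neq0 : m%:R != 0 :> R by rewrite pnatr_eq0; lia.
have piE : (pi_phi M phi m)%:R <=
    (\sum_(i < zarankiewicz n m d.+1) 'C(m ^ n, i))%:R :> R.
  by rewrite ler_nat pi_phi_zarankiewicz.
have first_bound : (2 <= n)%N \/ d = 0%N -> (pi_phi M phi m)%:R <=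
    2 `^ (c * m%:R `^ (n%:R - eps) * log2 m%:R).
  by move=> nd; apply: le_trans piE _; apply: asymptotic_bound.
have second_bound : 2 `^ (c * m%:R `^ (n%:R - eps) * log2 m%:R) <=
    2 `^ (m%:R `^ (n%:R - eps')).
  rewrite ler_powR ?ler1n //.
  apply: (@le_trans _ _ (m%:R `^ (n%:R - eps) * m%:R `^ (eps / 2))).
    by rewrite mulrAC mulrC ler_wpM2l // powR_ge0.
  rewrite -powRD ?m_neq0 ?implybT // ler_powR //; lra.
split=> //; have [n2|n_le1] := leqP 2 n.
  by apply: le_trans second_bound; apply: first_bound; left.
have nE : n = 1%N by lia.
subst n; have eps1 : eps = 1 by rewrite /eps subnn expr0 divr1.
apply: le_trans piE _; apply: le_trans (sum_bin_le_powR R _ n1 le2m) _.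
rewrite ler_powR ?ler1n // mul1r.
apply: (@le_trans _ _ (d.+1%:R * log2 m%:R)).
  by rewrite ler_wpM2r ?log2_ge0 ?(ltnW le2m) // ler_nat zarankiewicz_dim1.
by apply: le_trans logd _; rewrite ler_powR //; lra.
Qed.
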